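(* Let $A$ be an algebra over a field $F$ with $\operatorname{char}F=0$. Then $c_n(A,F)\leqslant c_n(A,0)$ for all $n\in\mathbb N$. Moreover, $c_n(A,\mathbb Q)=c_n(A,0)$ for all $n\in\mathbb N$.
   Context: Rings and algebras are associative, not necessarily with unit; $\mathbb N=\{1,2,\dots\}$. $\mathbb Z\langle X\rangle$ is the free associative ring without $1$ on $X=\{x_1,x_2,\dots\}$. For a ring $R$, $\operatorname{Id}(R,\mathbb Z)\subseteq\mathbb Z\langle X\rangle$ is the set of $f$ with $f(a_1,\dots,a_n)=0$ for all $a_i\in R$. $P_n(\mathbb Z)$ is the additive subgroup of $\mathbb Z\langle X\rangle$ generated by $x_{\sigma(1)}\cdots x_{\sigma(n)}$, $\sigma\in S_n$. $c_n(R,0)$ is the rank of the free part of the finitely generated abelian group $P_n(\mathbb Z)/(P_n(\mathbb Z)\cap\operatorname{Id}(R,\mathbb Z))$; an algebra is regarded as a ring here. For an algebra $A$ over a field $K$, $\operatorname{Id}(A,K)\subseteq K\langle X\rangle$ is the set of polynomial identities of $A$ with coefficients in $K$, $P_n(K)$ is the $K$-subspace of $K\langle X\rangle$ generated by $x_{\sigma(1)}\cdots x_{\sigma(n)}$, $\sigma\in S_n$, and $c_n(A,K):=\dim_K\frac{P_n(K)}{P_n(K)\cap\operatorname{Id}(A,K)}$. An $F$-algebra with $\operatorname{char}F=0$ is regarded as a $\mathbb Q$-algebra via $\mathbb Q\subseteq F$. *)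

(* Defs.v *)
From HB Require Import structures.
From mathcomp Require Import all_boot all_order perm all_algebra finmap.
From mathcomp Require Import boolp classical_sets.
From mathcomp.multinomials Require Import monalg.

Set Implicit Arguments.
Unset Strict Implicit.
Unset Printing Implicit Defensive.

Import GRing.Theory.

Local Open Scope ring_scope.

(* The library's rings all have a unit. *)

HB.mixin Record Zmodule_isNuRing R of GRing.Zmodule R := {
  numul : R -> R -> R;
  numulA : associative numul;
  numulDl : left_distributive numul +%R;
  numulDr : right_distributive numul +%R
}.

#[short(type="nuRingType")]
HB.structure Definition NuRing := {R of GRing.Zmodule R & Zmodule_isNuRing R}.

HB.mixin Record NuRing_isNuAlgebra (K : comNzRingType) A
    of NuRing A & GRing.Lmodule K A := {
  nuscalerAl : forall (a : K) (x y : A), a *: numul x y = numul (a *: x) y;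
  nuscalerAr : forall (a : K) (x y : A), a *: numul x y = numul x (a *: y)
}.

#[short(type="nuAlgType")]
HB.structure Definition NuAlgebra (K : comNzRingType) :=
  {A of NuRing A & GRing.Lmodule K A & NuRing_isNuAlgebra K A}.

Section NuRingTheory.
Variable R : nuRingType.
Implicit Types x y : R.

Lemma numul0x y : numul 0 y = 0.
Proof. by apply: (addIr (numul 0 y)); rewrite -numulDl !add0r. Qed.

Lemma numulx0 x : numul x 0 = 0.
Proof. by apply: (addIr (numul x 0)); rewrite -numulDr !add0r. Qed.

Lemma numulNx x y : numul (- x) y = - numul x y.
Proof. by apply/eqP; rewrite -addr_eq0 -numulDl addNr numul0x. Qed.

Lemma numulxN x y : numul x (- y) = - numul x y.
Proof. by apply/eqP; rewrite -addr_eq0 -numulDr addNr numulx0. Qed.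

Lemma numulMn x y n : numul x y *+ n = numul (x *+ n) y.
Proof. by elim: n => [|n IH]; rewrite ?numul0x // !mulrS numulDl IH. Qed.

Lemma numulnM x y n : numul x y *+ n = numul x (y *+ n).
Proof. by elim: n => [|n IH]; rewrite ?numulx0 // !mulrS numulDr IH. Qed.

(* [:: x_1; ...; x_n] |-> x_1 ... x_n; the value on [::] is meaningless, as
   there is no empty product in a ring without unit. *)
Definition nuprod (s : seq R) : R :=
  if s is x :: s' then foldl (@numul R) x s' else 0.

Lemma nuprod_cat s t : s != [::] -> t != [::] ->
  nuprod (s ++ t) = numul (nuprod s) (nuprod t).
Proof.
case: s t => [|x s] [|y t] //= _ _; rewrite foldl_cat /=.
elim/last_ind: t => [|t z IH] //; rewrite -!cats1 !foldl_cat /=.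
by rewrite !numulA; congr numul.
Qed.

End NuRingTheory.

(* [zmodule R] is the library's copy of R with its Z-module structure: a ring
   is an algebra over [int]. *)
Section RingAsZAlgebra.
Variable R : nuRingType.

HB.instance Definition _ := NuRing.copy (zmodule R) R.

Fact zmodule_scalerAl (a : int) (x y : zmodule R) :
  a *: numul x y = numul (a *: x) y.
Proof.
case: a => n; first exact: numulMn.
by rewrite NegzE !scaleNr numulNx; congr (- _); apply: numulMn.
Qed.

Fact zmodule_scalerAr (a : int) (x y : zmodule R) :
  a *: numul x y = numul x (a *: y).
Proof.
case: a => n; first exact: numulnM.
by rewrite NegzE !scaleNr numulxN; congr (- _); apply: numulnM.
Qed.

HB.instance Definition _ := NuRing_isNuAlgebra.Build int (zmodule R)
  zmodule_scalerAl zmodule_scalerAr.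

End RingAsZAlgebra.

(* A field of characteristic 0 contains the rationals through [ratr], which the
   library proves to be a morphism only when the target field is ordered. *)
Section RatInChar0.
Variables (F : fieldType) (charF0 : [pchar F] =i pred0).

Let intF_eq0 (z : int) : (z%:~R == 0 :> F) = (z == 0).
Proof.
have [/(_ charF0) natF_eq0 _] := pcharf0P F.
by case: z => n; rewrite ?NegzE ?mulrNz ?oppr_eq0 -pmulrn natF_eq0.
Qed.

Let denqF_neq0 x : (denq x)%:~R != 0 :> F.
Proof. by rewrite intF_eq0 denq_eq0. Qed.

Fact ratr0D (x y : rat) : ratr (x + y) = ratr x + ratr y :> F.
Proof.
have injZtoQ : injective (intr : int -> rat) by apply: intr_inj.
apply: (canLR (mulfK (denqF_neq0 _))); apply: (mulIf (denqF_neq0 x)).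
rewrite mulrAC mulrDl divfK // mulrAC -!rmorphM.
apply: (mulIf (denqF_neq0 y)); rewrite mulrAC mulrDl divfK //.
rewrite -!(rmorphM, rmorphD); congr _%:~R; apply: injZtoQ.
rewrite !(rmorphM, rmorphD) /= [_ + _]lock /= -lock !numqE.
by rewrite (mulrAC y) -!mulrDl -mulrA mulrAC !mulrA.
Qed.

Fact ratr0M (x y : rat) : ratr (x * y) = ratr x * ratr y :> F.
Proof.
have injZtoQ : injective (intr : int -> rat) by apply: intr_inj.
rewrite /ratr mulrC mulrAC; apply: canLR (mulKf (denqF_neq0 _)) _.
rewrite !mulrA; do 2!apply: canRL (mulfK (denqF_neq0 _)) _.
rewrite -!rmorphM; congr _%:~R.
apply: injZtoQ; rewrite !rmorphM [x * y]lock /= !numqE -lock.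
by rewrite -!mulrA mulrA mulrCA -!mulrA (mulrCA y).
Qed.

Fact ratr01 : ratr 1 = 1 :> F.
Proof. by rewrite /ratr divr1. Qed.

End RatInChar0.

(* A as an algebra over the rationals. *)
Definition ratScalars (F : fieldType) (charF0 : [pchar F] =i pred0)
  (A : nuAlgType F) : Type := A.

Section RatScalars.
Variables (F : fieldType) (charF0 : [pchar F] =i pred0) (A : nuAlgType F).
Local Notation A_Q := (ratScalars charF0 A).

HB.instance Definition _ := NuRing.copy A_Q A.

Definition rat_scale (q : rat) (x : A_Q) : A_Q := (ratr q : F) *: (x : A).

Fact rat_scaleA p q x : rat_scale p (rat_scale q x) = rat_scale (p * q) x.
Proof. by rewrite /rat_scale scalerA ratr0M. Qed.

Fact rat_scale1 : left_id 1 rat_scale.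
Proof. by move=> x; rewrite /rat_scale ratr01 scale1r. Qed.

Fact rat_scaleDr : right_distributive rat_scale +%R.
Proof. by move=> p x y; apply: scalerDr. Qed.

Fact rat_scaleDl x : {morph rat_scale^~ x : p q / p + q}.
Proof. by move=> p q; rewrite /rat_scale ratr0D // scalerDl. Qed.

HB.instance Definition _ := GRing.Zmodule_isLmodule.Build rat A_Q
  rat_scaleA rat_scale1 rat_scaleDr rat_scaleDl.

Fact rat_scaleAl (q : rat) (x y : A_Q) : q *: numul x y = numul (q *: x) y.
Proof. exact: (@nuscalerAl F A). Qed.

Fact rat_scaleAr (q : rat) (x y : A_Q) : q *: numul x y = numul x (q *: y).
Proof. exact: (@nuscalerAr F A). Qed.

HB.instance Definition _ := NuRing_isNuAlgebra.Build rat A_Q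
  rat_scaleAl rat_scaleAr.

End RatScalars.

Definition word : Type := seq nat.

HB.instance Definition _ := Choice.on word.

Fact word_unit (u v : word) : u ++ v = [::] -> u = [::] /\ v = [::].
Proof. by case: u. Qed.

HB.instance Definition _ :=
  Choice_isMonomialDef.Build word (@catA nat) (@cat0s nat) (@cats0 nat)
    word_unit.

(* The free algebra without unit K<X>: the elements of the free unital algebra
   {malg K[word]} with zero constant term.  The variables are numbered from 0. *)
Section FreeAlgebra.
Variable K : comNzRingType.

Definition noconst : {pred {malg K[word]}} := fun f => f@_([::] : word) == 0.

Fact noconst_submod : submod_closed noconst.
Proof.
split=> [|a f g]; first by rewrite unfold_in mcoeff0.
rewrite !unfold_in => /eqP f0 /eqP g0.
by rewrite mcoeffD mcoeffZ f0 g0 mulr0 addr0.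
Qed.

HB.instance Definition _ :=
  GRing.isSubmodClosed.Build K {malg K[word]} noconst noconst_submod.

Record freeAlg := FreeAlg { free_val : {malg K[word]}; _ : free_val \in noconst }.

HB.instance Definition _ := [isSub for free_val].
HB.instance Definition _ := [Choice of freeAlg by <:].
HB.instance Definition _ := [SubChoice_isSubLmodule of freeAlg by <:].

Fact free_mul_subproof (f g : freeAlg) : val f * val g \in noconst.
Proof.
rewrite unfold_in; have /eqP f0 := valP f.
have [/(_ (val f) (val g)) -> _] := @mcoeff1g_is_multiplicative word K.
by rewrite f0 mul0r.
Qed.

Definition free_mul f g : freeAlg := FreeAlg (free_mul_subproof f g).

Fact free_mulA : associative free_mul.
Proof. by move=> f g h; apply/val_inj/mulrA. Qed.

Fact free_mulDl : left_distributive free_mul +%R.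
Proof. by move=> f g h; apply/val_inj/mulrDl. Qed.

Fact free_mulDr : right_distributive free_mul +%R.
Proof. by move=> f g h; apply/val_inj/mulrDr. Qed.

HB.instance Definition _ :=
  Zmodule_isNuRing.Build freeAlg free_mulA free_mulDl free_mulDr.

Fact var_subproof (i : nat) : << [:: i] : word >> \in noconst.
Proof. by rewrite unfold_in mcoeffU1. Qed.

Definition var i : freeAlg := FreeAlg (var_subproof i).

Fact free_scalerAl (a : K) (f g : freeAlg) : a *: numul f g = numul (a *: f) g.
Proof. exact/val_inj/scalerAl. Qed.

Fact free_scalerAr (a : K) (f g : freeAlg) : a *: numul f g = numul f (a *: g).
Proof.
apply/val_inj/malgP => w /=; rewrite mcoeffZ.
rewrite [in RHS](mcoeffMlw _ (fsubset_refl _) (msuppZ_le _ _)) mcoeffMl mulr_sumr.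
apply: eq_bigr => u _; rewrite mulr_sumr; apply: eq_bigr => v _.
by rewrite mcoeffZ mulrnAr mulrCA.
Qed.

HB.instance Definition _ :=
  NuRing_isNuAlgebra.Build K freeAlg free_scalerAl free_scalerAr.

(* The value f(a_0, a_1, ...); by the lemmas below, f |-> f(a) is the unique
   morphism of algebras that maps each variable x_i to a_i. *)
Definition eval (A : nuAlgType K) (a : nat -> A) (f : freeAlg) : A :=
  \sum_(w <- msupp (val f)) (val f)@_w *: nuprod (map a w).

Section EvalTheory.
Variables (A : nuAlgType K) (a : nat -> A).

Let ev (h : {malg K[word]}) : A := \sum_(w <- msupp h) h@_w *: nuprod (map a w).

Let evEw (d : {fset word}) h : (msupp h `<=` d)%fset ->
  ev h = \sum_(w <- d) h@_w *: nuprod (map a w).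
Proof.
move=> le_d; rewrite /ev (big_fset_incl _ le_d) //= => w _ /mcoeff_outdom ->.
by rewrite scale0r.
Qed.

Let ev_linear : linear ev.
Proof.
move=> c f g; pose d := (msupp f `|` msupp g)%fset.
have le_f : (msupp f `<=` d)%fset := fsubsetUl _ _.
have le_g : (msupp g `<=` d)%fset := fsubsetUr _ _.
have le_h : (msupp (c *: f + g)%R `<=` d)%fset.
  apply: fsubset_trans (msuppD_le _ _) _.
  by rewrite fsetUSS ?fsubset_refl // msuppZ_le.
rewrite (evEw le_f) (evEw le_g) (evEw le_h) scaler_sumr -big_split /=.
by apply: eq_bigr => w _; rewrite mcoeffD mcoeffZ scalerDl scalerA.
Qed.

HB.instance Definition _ :=
  GRing.isLinear.Build K {malg K[word]} A _ ev ev_linear.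

Let evU c w : ev << c *g w >> = c *: nuprod (map a w).
Proof. by rewrite (evEw msuppU_le) big_seq_fset1 mcoeffUU. Qed.

Fact eval_linear : linear (eval a).
Proof. by move=> c f g; apply: (ev_linear c (val f) (val g)). Qed.

HB.instance Definition _ :=
  GRing.isLinear.Build K freeAlg A _ (eval a) eval_linear.

Lemma eval_var i : eval a (var i) = a i.
Proof. by rewrite /eval msuppU1 big_seq_fset1 mcoeffU1 eqxx scale1r. Qed.

Lemma evalM f g : eval a (numul f g) = numul (eval a f) (eval a g).
Proof.
have nz (h : freeAlg) w : w \in msupp (val h) -> map a w != [::].
  by case: w => //; rewrite -mcoeff_neq0 => /negP[]; apply: (valP h).
have sumMl (r : seq word) (F : word -> A) y :
    numul (\sum_(w <- r) F w) y = \sum_(w <- r) numul (F w) y.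
  by elim: r => [|w r IH]; rewrite ?big_nil ?numul0x // !big_cons numulDl IH.
have sumMr (r : seq word) (F : word -> A) x :
    numul x (\sum_(w <- r) F w) = \sum_(w <- r) numul x (F w).
  by elim: r => [|w r IH]; rewrite ?big_nil ?numulx0 // !big_cons numulDr IH.
rewrite -[LHS]/(ev (val f * val g)) malgME raddf_sum sumMl.
rewrite big_seq [RHS]big_seq; apply: eq_bigr => u fu.
rewrite raddf_sum sumMr big_seq [RHS]big_seq; apply: eq_bigr => v gv.
rewrite /= evU map_cat nuprod_cat ?(nz f u fu) ?(nz g v gv) //.
by rewrite -scalerA [in LHS]nuscalerAr nuscalerAl.
Qed.

End EvalTheory.

End FreeAlgebra.

Definition Id (K : comNzRingType) (A : nuAlgType K) : {pred freeAlg K} :=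
  fun f => `[< forall a : nat -> A, eval a f = 0 >].

Definition multilinear (K : comNzRingType) (n : nat) : {pred freeAlg K} :=
  fun f => `[< exists c : 'S_n -> K,
    f = \sum_(s : 'S_n) c s *: nuprod [seq var K (s i) | i : 'I_n] >].

Section Submodules.
Variables (K : comNzRingType) (A : nuAlgType K) (n : nat).

Fact Id_submod : submod_closed (Id A).
Proof.
split=> [|c f g /asboolP f0 /asboolP g0]; apply/asboolP => a.
  by rewrite linear0.
by rewrite linearP /= f0 g0 scaler0 addr0.
Qed.

HB.instance Definition _ :=
  GRing.isSubmodClosed.Build K (freeAlg K) (Id A) Id_submod.

Fact multilinear_submod : submod_closed (@multilinear K n).
Proof.
split=> [|c f g /asboolP[b ->] /asboolP[b' ->]]; apply/asboolP.
  by exists (fun=> 0); rewrite big1 // => s _; rewrite scale0r.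
exists (fun s => c * b s + b' s); rewrite scaler_sumr -big_split /=.
by apply: eq_bigr => s _; rewrite scalerA scalerDl.
Qed.

HB.instance Definition _ :=
  GRing.isSubmodClosed.Build K (freeAlg K) (@multilinear K n) multilinear_submod.

(* P_n(K) *)
Record multilinPoly :=
  MultilinPoly { mp_val : freeAlg K; _ : mp_val \in @multilinear K n }.

HB.instance Definition _ := [isSub for mp_val].
HB.instance Definition _ := [Choice of multilinPoly by <:].
HB.instance Definition _ := [SubChoice_isSubLmodule of multilinPoly by <:].

(* P_n(K) \cap Id(A, K), inside P_n(K) *)
Definition multilinId : {pred multilinPoly} := fun f => val f \in Id A.

Fact multilinId_submod : submod_closed multilinId.
Proof.
split=> [|c f g fI gI]; rewrite /multilinId unfold_in ?rpred0 //=.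
by rewrite rpredD ?rpredZ.
Qed.

HB.instance Definition _ :=
  GRing.isSubmodClosed.Build K multilinPoly multilinId multilinId_submod.

End Submodules.

(* The library provides the quotient {quot I} only as a Z-module. *)
Section QuotientModule.
Variables (K : pzRingType) (V : lmodType K) (I : submodClosed V).
Local Open Scope quotient_scope.

(* A constant on which the (otherwise not inferred) structure of Z-submodule of
   I can be declared. *)
Definition submod_pred : {pred V} := fun x => x \in I.

HB.instance Definition _ :=
  GRing.isSubmodClosed.Build K V submod_pred (submodClosedP I).

Definition submod_zmod : zmodClosed V := submod_pred.

Definition quotModule : Type := Quotient.quot submod_zmod.

HB.instance Definition _ := GRing.Zmodule.on quotModule.

Local Notation Q := (Quotient.quot submod_zmod).

Definition quot_scale (c : K) (x : Q) : Q := \pi_Q (c *: repr x).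

Fact pi_scale c (x : V) : quot_scale c (\pi_Q x) = \pi_Q (c *: x).
Proof.
apply/eqP; rewrite /quot_scale -Quotient.idealrBE -scalerBr.
by rewrite rpredZ // Quotient.idealrBE reprK.
Qed.

Fact quot_scaleA c d x : quot_scale c (quot_scale d x) = quot_scale (c * d) x.
Proof.
elim/quotW: x => x.
by rewrite (pi_scale d x) (pi_scale c (d *: x)) (pi_scale (c * d) x) scalerA.
Qed.

Fact quot_scale1 : left_id 1 quot_scale.
Proof. by elim/quotW => x; rewrite (pi_scale 1 x) scale1r. Qed.

Fact quot_scaleDr : right_distributive quot_scale +%R.
Proof.
move=> c; elim/quotW => x; elim/quotW => y.
by rewrite -raddfD (pi_scale c x) (pi_scale c y) (pi_scale c (x + y)) scalerDr
  raddfD.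
Qed.

Fact quot_scaleDl x : {morph quot_scale^~ x : c d / c + d}.
Proof.
elim/quotW: x => x c d.
by rewrite /= (pi_scale c x) (pi_scale d x) (pi_scale (c + d) x) scalerDl raddfD.
Qed.

HB.instance Definition _ := GRing.Zmodule_isLmodule.Build K quotModule
  quot_scaleA quot_scale1 quot_scaleDr quot_scaleDl.

End QuotientModule.

(* 0 if V has infinite dimension *)
Definition dimension (K : fieldType) (V : lmodType K) : nat :=
  xget 0%N (fun d => exists f : {linear V -> 'rV[K]_d}, bijective f).

(* The r such that G is isomorphic to Z^r x T with T finite; 0 if G is not
   finitely generated. *)
Definition free_rank (G : zmodType) : nat :=
  xget 0%N (fun r => exists (T : finZmodType) (f : {additive G -> 'rV[int]_r * T}),
    bijective f).

Definition multilinQuot (K : comNzRingType) (A : nuAlgType K) (n : nat)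
  : lmodType K := quotModule (@multilinId K A n).

(* c_n(A, K) *)
Definition codim (K : fieldType) (A : nuAlgType K) (n : nat) : nat :=
  dimension (multilinQuot A n).

(* c_n(R, 0) *)
Definition codim0 (R : nuRingType) (n : nat) : nat :=
  free_rank (multilinQuot (zmodule R) n).

(* Main.v *)
Require Import Defs.
From mathcomp Require Import all_boot all_algebra.
From HB Require Import structures.
From mathcomp Require Import perm boolp classical_sets.
Import GRing.Theory.
Local Open Scope ring_scope.

(** Write N = n!.  For each scalar ring K, coefficient vectors x in K^N map onto
P_n(K) / (P_n(K) \cap Id(A, K)) through [word_class], and x is killed exactly
when the multilinear polynomial with coefficients x vanishes on A
([word_class_eq0]).  This last condition is the same for an integer vector
whether it is read over Z, over Q or over F ([word_class_intr]); so all three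
codimensions are governed by one lattice I in Z^N, the integral identities.

The rational identities form a subspace of Q^N, hence the left kernel of a
rational matrix ([kernel_matrix]).  Smith normal form replaces this matrix by an
integral H : Z^N -> Z^r with the same kernel over Q and with a right inverse G
defined over Z ([rational_kernel_split]).  Thus I is the kernel of a split
surjection Z^N -> Z^r, and the quotients over Z and over Q are Z^r and Q^r: both
codimensions are r, once the rank is known to be an invariant
([surjective_linear_leq]).

Over F only one inclusion survives.  The rows of 1 - H G are integral
identities, so every x in F^N has the same class as (x H) G; hence the r vectors
given by the rows of G already span the quotient and its dimension is at most r.
Further identities with coefficients in F can make it smaller. *)

(** * Kernels of linear maps on row vectors *)

Section Kernels.
Set Implicit Arguments.

(** Preimages of the unit vectors form a one-sided inverse matrix, and such
inverses bound dimensions over every nonzero commutative ring. *)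
Lemma surjective_linear_leq (K : comNzRingType) (m d : nat)
    (f : {linear 'rV[K]_m -> 'rV[K]_d}) :
  (forall y, exists x, f x = y) -> (d <= m)%N.
Proof.
move=> f_surj.
have [g fg] := fin_all_exists (fun i : 'I_d => f_surj (delta_mx 0 i)).
apply: (@mulmx1_min K d m (\matrix_i g i) (lin1_mx f)).
by apply/row_matrixP => i; rewrite row_mul rowK mul_rV_lin1 fg row1.
Qed.

(** Used to recognise a quotient V as free: phi presents V and psi maps onto a
free module.  The isomorphism lifts along phi and then applies psi. *)
Lemma kernel_isomorphism (K : pzRingType) (U V W : lmodType K)
    (phi : {linear U -> V}) (psi : {linear U -> W}) :
    (forall v, exists x, phi x = v) -> (forall w, exists x, psi x = w) ->
    (forall x, phi x = 0 <-> psi x = 0) ->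
  exists f : {linear V -> W}, bijective f.
Proof.
move=> /choice[h phih] /choice[k psik] ker_eq.
have psi_h x : psi (h (phi x)) = psi x.
  by apply/subr0_eq; rewrite -linearB; apply/ker_eq; rewrite linearB /= phih subrr.
have phi_k x : phi (k (psi x)) = phi x.
  by apply/subr0_eq; rewrite -linearB; apply/ker_eq; rewrite linearB /= psik subrr.
pose f v := psi (h v).
have f_lin : linear f.
  by move=> c u v; rewrite /f -{1}(phih u) -{1}(phih v) -linearP psi_h linearP.
pose fL := GRing.isLinear.Build K V W _ f f_lin.
pose f' : {linear V -> W} := HB.pack f fL.
exists f', (fun w => phi (k w)) => [v|w] /=.
  by rewrite /f phi_k phih.
by rewrite /f psi_h psik.
Qed.

(** Among the matrices whose row space lies in the kernel, one of maximal rank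
spans the whole kernel; its cokernel matrix is the required W. *)
Lemma kernel_matrix (K : fieldType) (V : lmodType K) (m : nat)
    (phi : {linear 'rV[K]_m -> V}) :
  exists W : 'M[K]_m, forall x, phi x = 0 <-> x *m W = 0.
Proof.
pose P k := `[< exists2 M : 'M[K]_m,
  \rank M = k & forall x, (x <= M)%MS -> phi x = 0 >].
have P0 : exists k, P k.
  exists 0%N; apply/asboolP; exists 0 => [|x]; first exact: mxrank0.
  by rewrite submx0 => /eqP->; apply: linear0.
have Pm k : P k -> (k <= m)%N by case/asboolP=> M <- _; apply: rank_leq_row.
case: (ex_maxnP P0 Pm) => k /asboolP[M rkM kerM] maxk.
exists (cokermx M) => x; split=> [x0|xM0]; last by apply: kerM; rewrite submxE xM0.
apply/eqP; rewrite -submxE.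
have leM : (M <= M + x)%MS by apply: addsmxSl.
suff /eqmxP eqM : (M == M + x)%MS by rewrite eqM addsmxSr.
rewrite -(geq_leqif (mxrank_leqif_eq leM)) rkM; apply: maxk.
apply/asboolP; exists (M + x)%MS => // y /sub_addsmxP[[u v] /= ->].
rewrite linearD /= (kerM _ (submxMl _ _)) add0r (mx11_scalar v) mul_scalar_mx.
by rewrite linearZ /= x0 scaler0.
Qed.

Lemma clear_denominators (m p : nat) (W : 'M[rat]_(m, p)) :
  exists (W' : 'M[int]_(m, p)) (a : int),
    a != 0 /\ map_mx intr W' = a%:~R *: W.
Proof.
have [q [a a_neq0 def_W]] := rat_poly_scale (rVpoly (mxvec W)).
exists (\matrix_(i, j) q`_(mxvec_index i j)), a; split=> //.
apply/matrixP=> i j; rewrite !mxE -(mxvecE W) -coef_rVpoly_ord def_W.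
by rewrite coefZ coef_map mulVKf // intr_eq0.
Qed.

(** After clearing denominators, Smith normal form gives W = L D R up to a
nonzero scalar, with L and R invertible over Z and D diagonal.  Then x W = 0 says
that x L vanishes at the indices J of the nonzero diagonal entries: H selects the
columns J of L, and G the rows J of L^-1. *)
Lemma rational_kernel_split (m p : nat) (W : 'M[rat]_(m, p)) :
  exists (r : nat) (H : 'M[int]_(m, r)) (G : 'M[int]_(r, m)),
    G *m H = 1%:M /\ forall x : 'rV[rat]_m, x *m W = 0 <-> x *m map_mx intr H = 0.
Proof.
have [W' [a [a_neq0 def_W']]] := clear_denominators W.
have [L L_unit [R R_unit [d _ defW]]] := int_Smith_normal_form W'.
pose J := [pred i : 'I_m | (i < p)%N && (d`_i != 0)].
pose e (k : 'I_#|J|) : 'I_m := enum_val k.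
exists #|J|, (colsub e L), (rowsub e (invmx L)); split.
  rewrite mul_rowsub_mx mulmx_colsub mulVmx //.
  by apply/matrixP=> i j; rewrite !mxE (inj_eq (@enum_val_inj _ _)).
move=> x.
have [y def_y] : exists y, y = x *m map_mx intr L :> 'rV[rat]_m by eexists.
pose D : 'M[int]_(m, p) := \matrix_(i, j) (d`_i *+ (i == j :> nat)).
have yD : x *m W = 0 <-> y *m map_mx intr D = 0.
  have intRK : map_mx intr R *m map_mx intr (invmx R) = 1%:M :> 'M[rat]_p.
    by rewrite -map_mxM mulmxV // map_mx1.
  have a_unit : a%:~R != 0 :> rat by rewrite intr_eq0.
  have def_xW : a%:~R *: (x *m W) = y *m map_mx intr D *m map_mx intr R.
    by rewrite scalemxAr -def_W' defW !map_mxM !mulmxA def_y.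
  split=> [xW0|yD0]; last first.
    by apply: (scalerI a_unit); rewrite def_xW yD0 mul0mx scaler0.
  by rewrite -[LHS]mulmx1 -intRK mulmxA -def_xW xW0 scaler0 mul0mx.
have yH : x *m map_mx intr (colsub e L) = 0 <-> forall i, J i -> y 0 i = 0.
  have -> : x *m map_mx intr (colsub e L) = colsub e y.
    by rewrite map_mxsub mulmx_colsub def_y.
  split=> [y0 i Ji|y0]; last first.
    by apply/rowP=> k; rewrite !mxE; apply: y0; have := enum_valP k.
  by have /rowP/(_ (enum_rank_in Ji i)) := y0; rewrite !mxE /e enum_rankK_in.
rewrite yD yH; split=> [yD0 i /andP[ltip di0]|y0].
  have /rowP/(_ (Ordinal ltip)) := yD0; rewrite !mxE (bigD1 i) //= big1 => [|j ji].
    rewrite !mxE eqxx addr0 => /eqP; rewrite mulf_eq0 intr_eq0 (negPf di0) orbF.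
    by move/eqP.
  by rewrite !mxE /= (negPf (ji : nat_of_ord j != i)) mulr0.
apply/rowP=> j; rewrite !mxE big1 // => i _; rewrite !mxE.
have [ij|_] := eqVneq; last by rewrite mulr0.
have [->|di0] := eqVneq d`_i 0; first by rewrite mulr0.
by rewrite y0 ?mul0r //= di0 ij ltn_ord.
Qed.

End Kernels.

(** * Computing dimensions and free ranks *)

Section Invariants.
Set Implicit Arguments.

Lemma dimension_eq (K : fieldType) (V : lmodType K) (r : nat)
    (f : {linear V -> 'rV[K]_r}) :
  bijective f -> dimension V = r.
Proof.
have leq_dim m d (g : {linear V -> 'rV[K]_m}) (h : {linear V -> 'rV[K]_d}) :
    bijective g -> bijective h -> (d <= m)%N.
  move=> [g' gK g'K] [h' hK h'K].
  pose gL := GRing.isLinear.Build K _ _ _ g' (can2_linear gK g'K).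
  pose g'L : {linear 'rV[K]_m -> V} := HB.pack g' gL.
  apply: (surjective_linear_leq (h \o g'L)) => y; exists (g (h' y)).
  by rewrite /= gK h'K.
move=> f_bij; apply: xget_unique => [|d [g g_bij]]; first by exists f.
by apply/eqP; rewrite eqn_leq (leq_dim _ _ f g) ?(leq_dim _ _ g f).
Qed.

Lemma dimension_leq (K : fieldType) (V : lmodType K) (r : nat)
    (phi : {linear 'rV[K]_r -> V}) :
  (forall v, exists x, phi x = v) -> (dimension V <= r)%N.
Proof.
move=> phi_surj; rewrite /dimension.
(* In the case where V has no finite basis, the value of [dimension] is 0. *)
case: xgetP => [d _ [f [f' fK f'K]]|_]; last exact: leq0n.
apply: (surjective_linear_leq (f \o phi)) => y.
by have [x phix] := phi_surj (f' y); exists x; rewrite /= phix f'K.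
Qed.

(** Translation by t permutes T, so it does not change the sum of all elements,
to which it adds #|T| times t. *)
Lemma finZmod_torsion (T : finZmodType) (t : T) : t *+ #|T| = 0.
Proof.
have shift_bij : bijective (fun x : T => x + t).
  by exists (fun x => x - t) => x; rewrite ?addrK ?subrK.
have : \sum_(x : T) x = \sum_(x : T) x + t *+ #|T|.
  by rewrite -sumr_const -big_split /= [LHS](reindex _ (onW_bij _ shift_bij)).
by move/eqP; rewrite addrC -subr_eq subrr eq_sym => /eqP.
Qed.

(** An additive map from Z^r x T to the torsion-free Z^r' kills T, so the
surjection of Z^r x T onto Z^r' is already surjective on Z^r. *)
Lemma free_rank_leq (G : zmodType) (r r' : nat) (T T' : finZmodType)
    (f : {additive G -> 'rV[int]_r * T}) (g : {additive G -> 'rV[int]_r' * T'}) :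
  bijective f -> bijective g -> (r' <= r)%N.
Proof.
move=> [f' fK f'K] [g' gK g'K].
have f'D : zmod_morphism f' := can2_zmod_morphism fK f'K.
pose h (u : 'rV[int]_r * T) : 'rV[int]_r' := (g (f' u)).1.
have hB : zmod_morphism h by move=> u v; rewrite /h f'D raddfB.
pose hL : {additive ('rV[int]_r * T)%type -> 'rV[int]_r'} :=
  HB.pack h (GRing.isZmodMorphism.Build _ _ h hB).
have kill_torsion t : h (0, t) = 0.
  have pairMn k : (0, t) *+ k = (0, t *+ k) :> 'rV[int]_r * T.
    by elim: k => // k IH; rewrite !mulrS IH; congr pair; apply: addr0.
  have : h (0, t) *+ #|T| = 0.
    by rewrite -[h]/(hL : _ -> _) -raddfMn pairMn finZmod_torsion raddf0.
  move=> /rowP ht0; apply/rowP=> j; have := ht0 j.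
  rewrite mulmxnE [RHS]mxE => /eqP; rewrite Num.Theory.mulrn_eq0.
  case/orP=> [/eqP T0|/eqP->].
    by have := card0_eq T0 t.
  by rewrite mxE.
have h_fst u : h u = h (u.1, 0).
  case: u => x t; rewrite -[LHS]subr0 -(kill_torsion t) -hB /=.
  by congr (h (_, _)); rewrite /= ?subr0 ?subrr.
pose k (x : 'rV[int]_r) := h (x, 0).
have kB : zmod_morphism k.
  by move=> x y; rewrite /k -hB; congr (h (_, _)); rewrite /= subr0.
pose kA : {additive 'rV[int]_r -> 'rV[int]_r'} :=
  HB.pack k (GRing.isZmodMorphism.Build _ _ k kB).
have k_lin : linear k.
  move=> c x y; rewrite -[c]intz !scaler_int.
  by rewrite -[k]/(kA : _ -> _) raddfD raddfMz.
pose kL : {linear 'rV[int]_r -> 'rV[int]_r'} :=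
  HB.pack k (GRing.isLinear.Build int _ _ _ k k_lin).
apply: (surjective_linear_leq kL) => y; exists (f (g' (y, 0))).1.
rewrite -[LHS]/(h ((f (g' (y, 0))).1, 0)) -h_fst.
by rewrite /h fK g'K.
Qed.

Lemma free_rank_eq (G : zmodType) (r : nat) (f : {additive G -> 'rV[int]_r}) :
  bijective f -> free_rank G = r.
Proof.
move=> [f' fK f'K].
pose g (x : G) : 'rV[int]_r * 'I_1 := (f x, 0).
have gB : zmod_morphism g.
  by move=> x y; rewrite /g raddfB; congr pair; rewrite subrr.
pose gL : {additive G -> ('rV[int]_r * 'I_1)%type} :=
  HB.pack g (GRing.isZmodMorphism.Build _ _ g gB).
have g_bij : bijective gL.
  by exists (f' \o fst) => [x|[x t]]; rewrite /= /g /= ?fK // f'K (ord1 t).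
(* 'I_1 serves as the trivial torsion part. *)
apply: xget_unique => [|d [T [h h_bij]]]; first by exists 'I_1, gL.
by apply/eqP; rewrite eqn_leq (free_rank_leq gL h) ?(free_rank_leq h gL).
Qed.

End Invariants.

(** * Multilinear polynomials modulo identities *)

Section MultilinearQuotient.
Set Implicit Arguments.
Unset Strict Implicit.
Variables (K : comNzRingType) (A : nuAlgType K) (n : nat).
Local Notation N := #|{: 'S_n}|.

Lemma eval_nuprod (a : nat -> A) (s : seq (freeAlg K)) :
  eval a (nuprod s) = nuprod (map (eval a) s).
Proof.
case: s => [|x s] /=; first exact: linear0.
by elim: s x => //= y s IH x; rewrite IH evalM.
Qed.

Definition word_value (a : nat -> A) (s : 'S_n) : A :=
  nuprod [seq a (s i) | i : 'I_n].

Fact word_sum_multilinear (x : 'rV[K]_N) :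
  \sum_(s : 'S_n) x 0 (enum_rank s) *: nuprod [seq var K (s i) | i : 'I_n]
    \in @multilinear K n.
Proof. by apply/asboolP; exists (fun s => x 0 (enum_rank s)). Qed.

(** Indexing the coefficients by 'I_N instead of by permutations makes the kernel
of the quotient map accessible to matrix computations. *)
Definition word_sum x : multilinPoly K n := MultilinPoly (word_sum_multilinear x).

Fact word_sum_linear : linear word_sum.
Proof.
move=> c x y; apply/val_inj; rewrite /= scaler_sumr -big_split /=.
by apply: eq_bigr => s _; rewrite scalerA -scalerDl !mxE.
Qed.

HB.instance Definition _ := GRing.isLinear.Build K 'rV[K]_N (multilinPoly K n) _
  word_sum word_sum_linear.

Definition word_class (x : 'rV[K]_N) : multilinQuot A n :=
  (\pi_(Quotient.quot (submod_zmod (@multilinId K A n))) (word_sum x))%qT.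

Fact word_class_linear : linear word_class.
Proof.
move=> c x y; rewrite /word_class linearP raddfD; congr (_ + _).
exact: esym (pi_scale (@multilinId K A n) c (word_sum x)).
Qed.

HB.instance Definition _ := GRing.isLinear.Build K 'rV[K]_N (multilinQuot A n) _
  word_class word_class_linear.

Lemma word_class_surj v : exists x, word_class x = v.
Proof.
elim/quotW: v => f; have /asboolP[c def_f] := valP f.
exists (\row_k c (enum_val k)); rewrite /word_class; congr (\pi_ _ _)%qT.
apply/val_inj; rewrite /= [RHS]def_f; apply: eq_bigr => s _.
by rewrite mxE enum_rankK.
Qed.

Lemma word_class_eq0 x : word_class x = 0 <->
  forall a : nat -> A, \sum_(s : 'S_n) x 0 (enum_rank s) *: word_value a s = 0.
Proof.
have ev a : eval a (val (word_sum x)) =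
    \sum_(s : 'S_n) x 0 (enum_rank s) *: word_value a s.
  rewrite linear_sum /=; apply: eq_bigr => s _.
  rewrite linearZ /= eval_nuprod /word_value -map_comp; congr (_ *: nuprod _).
  by apply: eq_map => i; apply: eval_var.
have -> : word_class x = 0 <-> word_sum x \in @multilinId K A n.
  have := Quotient.idealrBE (submod_zmod (@multilinId K A n)) (word_sum x) 0.
  rewrite subr0 raddf0 => eq0.
  split=> [x0|xI]; last by apply/eqP; apply: etrans xI; apply: esym.
  by apply: etrans eq0 _; apply/eqP.
split=> [/asboolP xI a|xI]; first by rewrite -ev.
by apply/asboolP=> a; rewrite ev.
Qed.

End MultilinearQuotient.

(** * Change of scalars *)

(** An integer acts on A through the ring K exactly as it does through the
additive group of A. *)
Lemma word_class_intr (K : comNzRingType) (A : nuAlgType K) (n : nat)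
    (x : 'rV[int]_#|{: 'S_n}|) :
  word_class (zmodule A) x = 0 <-> word_class A (map_mx intr x) = 0.
Proof.
rewrite !word_class_eq0.
have sumE (a : nat -> A) :
    \sum_s x 0 (enum_rank s) *: word_value (a : nat -> zmodule A) s =
    \sum_s map_mx intr x 0 (enum_rank s) *: word_value a s :> A.
  by apply: eq_bigr => s _; rewrite mxE -[x 0 _ in LHS]intz !scaler_int.
by split=> x0 a; [rewrite -[LHS]sumE | rewrite [LHS]sumE]; apply: x0.
Qed.

Lemma codim_rat_field (F : fieldType) (charF0 : [pchar F] =i pred0)
    (A : nuAlgType F) (n : nat) :
  codim (ratScalars charF0 A) n = codim0 A n /\ (codim A n <= codim0 A n)%N.
Proof.
pose A_Q := ratScalars charF0 A; pose A_Z := zmodule A.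
have [W kerW] := kernel_matrix (@word_class _ A_Q n).
have [r [H [G [GH1 kerH]]]] := rational_kernel_split W.
have kerQ x : word_class A_Q x = 0 <-> x *m map_mx intr H = 0.
  by rewrite kerW kerH.
have kerZ x : word_class A_Z x = 0 <-> x *m H = 0.
  apply: iff_trans (@word_class_intr rat A_Q n x) _.
  rewrite kerQ -map_mxM -(map_mx0 intr).
  split=> [/matrixP eqH|-> //]; apply/matrixP=> i j.
  by apply: (@intr_inj rat); have := eqH i j; rewrite !mxE.
have -> : codim0 A n = r.
  have H_surj (y : 'rV[int]_r) : exists x, mulmxr H x = y.
    by exists (y *m G); rewrite /= -mulmxA GH1 mulmx1.
  have [f f_bij] := kernel_isomorphism (@word_class _ A_Z n) (mulmxr H)
    (@word_class_surj _ A_Z n) H_surj kerZ.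
  exact: free_rank_eq f_bij.
split.
  have H_surj (y : 'rV[rat]_r) : exists x, mulmxr (map_mx intr H) x = y.
    exists (y *m map_mx intr G).
    by rewrite /= -mulmxA -map_mxM GH1 map_mx1 mulmx1.
  have [f f_bij] := kernel_isomorphism (@word_class _ A_Q n)
    (mulmxr (map_mx intr H)) (@word_class_surj _ A_Q n) H_surj kerQ.
  exact: dimension_eq f_bij.
(* x = (x H) G modulo the span over F of the integral identities. *)
have residue_eq0 (x : 'rV[F]_#|{: 'S_n}|) :
    word_class A (x *m map_mx intr (1%:M - H *m G)) = 0.
  rewrite mulmx_sum_row linear_sum big1 // => i _; rewrite linearZ /= -map_row.
  suff /word_class_intr-> : word_class A_Z (row i (1%:M - H *m G)) = 0.
    by rewrite scaler0.
  by apply/kerZ; rewrite -row_mul mulmxBl mul1mx -mulmxA GH1 mulmx1 subrr row0.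
pose phi : {linear 'rV[F]_r -> multilinQuot A n} :=
  @word_class F A n \o mulmxr (map_mx intr G).
apply: (dimension_leq phi) => v.
have [x <-] := word_class_surj v; exists (x *m map_mx intr H).
apply/esym/subr0_eq; rewrite -(residue_eq0 x) /= -linearB; congr word_class.
by rewrite -mulmxA -map_mxM raddfB /= map_mx1 mulmxBr mulmx1.
Qed.

Theorem proposition2 (F : fieldType) (charF0 : [pchar F] =i pred0)
  (A : nuAlgType F) :
  (forall n : nat, (0 < n)%N -> (codim A n <= codim0 A n)%N) /\
  (forall n : nat, (0 < n)%N -> codim (ratScalars charF0 A) n = codim0 A n).
Proof.
by split=> n _; have [codimQ codimF] := codim_rat_field charF0 A n.
Qed.
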